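(* Suppose a group $G$ acts without inversions and $K$-acylindrically on a simplicial tree $T$, and let $N$ be the smallest integer greater than or equal to $\frac{K}{2}+1$. (1) If $g\in G$ is hyperbolic then either $\operatorname{scl}(g)=0$ or $\operatorname{scl}(g)\geq \frac{1}{12N}$. (2) If $g\in G$ is hyperbolic and $|g|\geq K$ then either $\operatorname{scl}(g)=0$ or $\operatorname{scl}(g)\geq \frac1{24}$. In both cases, $\operatorname{scl}(g)=0$ if and only if $g$ is conjugate to $g^{-1}$.
   Context: Edges of $T$ have length one; a segment is a subset isometric to a closed interval of $\mathbb{R}$. $G$ acts $K$-acylindrically on $T$ ($K\ge 0$) if the (pointwise) stabilizer of any segment of length $K$ is trivial. For $g\in G$, the translation length is $|g|=\min_{x\in T}d(x,gx)$, and $g$ is hyperbolic if $|g|>0$. Stable commutator length in a group $G$: for $g\in[G,G]$, $\operatorname{scl}(g)=\lim_{n\to\infty}\operatorname{cl}(g^n)/n$, where $\operatorname{cl}$ is the least number of commutators whose product is the given element; if $g^k\in[G,G]$ for some $k\ge1$, $\operatorname{scl}(g)=\operatorname{scl}(g^k)/k$; otherwise $\operatorname{scl}(g)=\infty$. *)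

(* Defs.v *)
From HB Require Import structures.
From mathcomp Require Import all_boot all_order all_algebra.
From mathcomp Require Import all_classical all_reals all_analysis.

Set Implicit Arguments.
Unset Strict Implicit.
Unset Printing Implicit Defensive.

Import Order.TTheory GRing.Theory Num.Theory.
Import numFieldNormedType.Exports.

Local Open Scope classical_set_scope.
Local Open Scope ring_scope.

Definition least (P : nat -> Prop) : nat :=
  xget 0%N [set n | P n /\ forall m, P m -> (n <= m)%N].

Definition commutator_product (G : groupType) (n : nat) (g : G) : Prop :=
  exists2 s : seq (G * G), size s = n & g = (\prod_(p <- s) [~ p.1, p.2])%g.

(* Inverses of commutators are commutators, so the subgroup [G, G] generated by
   the commutators consists of their finite products. *)
Definition in_commutator_subgroup (G : groupType) (g : G) : Prop :=
  exists n, commutator_product n g.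

(* Junk value 0 outside [G, G]. *)
Definition cl (G : groupType) (g : G) : nat :=
  least (fun n => commutator_product n g).

(* Meaningful for g in [G, G] only, see scl below. *)
Definition scl_lim (R : realType) (G : groupType) (g : G) : R :=
  lim ((fun n : nat => (cl (g ^+ n)%g)%:R / n%:R : R) @ \oo).

(* The value scl_lim (g ^+ k) / k does not depend on the choice of k; for g in
   [G, G] the least k is 1, which gives back scl_lim g. *)
Definition scl (R : realType) (G : groupType) (g : G) : \bar R :=
  let P k := (0 < k)%N /\ in_commutator_subgroup (g ^+ k)%g in
  if `[< exists k, P k >]
  then (scl_lim R (g ^+ least P)%g / (least P)%:R)%:E
  else +oo%E.

Definition is_tree (V : eqType) (adj : rel V) : Prop :=
  [/\ inhabited V, symmetric adj, irreflexive adj,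
      forall u v : V, exists2 p : seq V, path adj u p & last u p = v
    & forall c : seq V, ucycle adj c -> (size c <= 2)%N].

Definition is_simplicial_action (G : groupType) (V : eqType) (adj : rel V)
    (act : G -> V -> V) : Prop :=
  [/\ forall v, act 1%g v = v,
      forall g h v, act (g * h)%g v = act g (act h v)
    & forall g u v, adj (act g u) (act g v) = adj u v].

Definition without_inversions (G : groupType) (V : eqType) (adj : rel V)
    (act : G -> V -> V) : Prop :=
  forall g u v, adj u v -> ~ (act g u = v /\ act g v = u).

(* Points of the geometric realization are given by barycentric coordinates:
   edge_point u v t is the point (1 - t) u + t v of the closed edge uv. *)
Definition edge_point (R : realType) (V : eqType) (u v : V) (t : R) : V -> R :=
  fun w => (1 - t) * (w == u)%:R + t * (w == v)%:R.

(* The case u = v provides the vertices, also when there are no edges. *)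
Definition realization (R : realType) (V : eqType) (adj : rel V) :
    set (V -> R) :=
  [set x | exists u v (t : R), [/\ u = v \/ adj u v, 0 <= t <= 1
                           & x = edge_point u v t]].

(* string adj x y l: there is a finite chain of points from x to y, consecutive
   ones lying in a common closed edge, of total length l. *)
Inductive string (R : realType) (V : eqType) (adj : rel V) :
    (V -> R) -> (V -> R) -> R -> Prop :=
| string_nil x : realization adj x -> string adj x x 0
| string_cons u v s t y l :
    adj u v -> 0 <= s <= 1 -> 0 <= t <= 1 ->
    string adj (edge_point u v t) y l ->
    string adj (edge_point u v s) y (`|s - t| + l).

(* The length metric in which every edge is isometric to [0, 1]. *)
Definition tree_dist (R : realType) (V : eqType) (adj : rel V)
    (x y : V -> R) : R :=
  inf [set l | string adj x y l].

(* The affine extension of the action on vertices: it sends edge_point u v t to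
   edge_point (act g u) (act g v) t. *)
Definition point_act (R : realType) (G : groupType) (V : eqType)
    (act : G -> V -> V) (g : G) (x : V -> R) : V -> R :=
  fun w => x (act g^-1%g w).

(* S is the image of an isometric embedding of the interval [0, K]. *)
Definition is_segment (R : realType) (V : eqType) (adj : rel V) (K : R)
    (S : set (V -> R)) : Prop :=
  exists f : R -> (V -> R),
    [/\ f @` `[0, K] = S, S `<=` realization adj
      & forall s t, 0 <= s <= K -> 0 <= t <= K ->
          tree_dist adj (f s) (f t) = `|s - t|].

Definition acylindrical (R : realType) (G : groupType) (V : eqType)
    (adj : rel V) (act : G -> V -> V) (K : R) : Prop :=
  forall S : set (V -> R), is_segment adj K S ->
  forall g : G, (forall x, S x -> point_act act g x = x) -> g = 1%g.

(* For a simplicial action on a tree this infimum is a minimum. *)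
Definition translation_length (R : realType) (G : groupType) (V : eqType)
    (adj : rel V) (act : G -> V -> V) (g : G) : R :=
  inf [set tree_dist adj x (point_act act g x) | x in realization adj].

Definition hyperbolic (R : realType) (G : groupType) (V : eqType)
    (adj : rel V) (act : G -> V -> V) (g : G) : Prop :=
  0 < translation_length R adj act g.

(* Main.v *)
Require Import Defs.
From HB Require Import structures.
From mathcomp Require Import all_boot all_order all_algebra.
From mathcomp Require Import all_classical all_reals all_analysis.
From mathcomp Require Import zify lra.
Import Order.TTheory GRing.Theory Num.Theory.
Import numFieldNormedType.Exports.

Set Implicit Arguments.
Unset Strict Implicit.
Unset Printing Implicit Defensive.

Local Open Scope classical_set_scope.
Local Open Scope ring_scope.

(** Let g be hyperbolic with axis L and translation length l, and let the pattern
    be a segment of L made of N periods. Call the translates of the pattern by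
    elements of G its copies. For a in G let f a be the maximal number of
    disjoint copies along the geodesic from x to a x, minus the same number for
    the reversed geodesic, where x is the beginning of the pattern.

    Cutting a path loses at most one copy ([packing_number_cat]), and the three
    sides of a geodesic triangle are glued from three legs ([tripod]), so f has
    defect 3 ([countingM]); moreover f (a^-1) = - f a ([countingV]). A product of
    n commutators is a product of 4 n letters on which the values of f cancel in
    pairs, so f is at most 12 n on it
    ([quasimorphism_commutator_product]). Working with f itself, and not with its
    homogenization, keeps the constant 12 without an appeal to Bavard duality.

    Along L the powers of g^N produce one copy each. If L carries no reversed
    copy, then f (g^m) is at least floor(m / N) ([counting_axis]), so cl (g^m)
    is at least about m / (12 N) and scl g >= 1 / (12 N) ([scl_ge]).

    Suppose that L does carry a reversed copy: some h maps N periods of L into L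
    and reverses the direction. Then h^-1 g h translates along L in the direction
    opposite to g, so (h^-1 g h) g fixes N - 1 periods ([flips_axis_fix]). If
    these have length at least K, acylindricity yields h^-1 g h = g^-1. The
    length (N - 1) l is at least K when N = 2 and l >= K, and also when
    N >= K / 2 + 1 and l >= 2; if l = 1, all edges of L are translates of one
    another by powers of g, and a reversed copy would invert an edge
    ([flips_axis_inversion]). Finally, if h^-1 g h = g^-1 then every even power
    of g is a single commutator, so scl g = 0 ([inverted_scl_eq0]).

    The remaining work links these combinatorial facts with the metric notions:
    an element that fixes the first n + 1 vertices of a ray fixes an
    isometrically embedded interval of length n ([acylindrical_ray]), a
    hyperbolic element fixes no vertex, and an element without fixed vertices
    and inversions has an axis ([axis_exists]). *)

(** * Reduced walks in a tree *)

Section Walks.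
Local Open Scope nat_scope.
Variables (V : eqType) (adj : rel V).

Definition flip (e : V * V) : V * V := (e.2, e.1).

Definition reverse_walk (w : seq (V * V)) := rev (map flip w).

Fixpoint walk (x : V) (w : seq (V * V)) (y : V) : bool :=
  if w is e :: w' then [&& e.1 == x, adj e.1 e.2 & walk e.2 w' y] else x == y.

Definition onward (e f : V * V) := f != flip e.

Definition reduced (w : seq (V * V)) := sorted onward w.

Lemma flipK : involutive flip. Proof. by case. Qed.

Lemma reverse_walkK : involutive reverse_walk.
Proof.
move=> w; rewrite /reverse_walk map_rev revK -map_comp.
by rewrite (eq_map (g := id)) ?map_id // => e; rewrite /= flipK.
Qed.

Lemma reverse_walk_cat u v :
  reverse_walk (u ++ v) = reverse_walk v ++ reverse_walk u.
Proof. by rewrite /reverse_walk map_cat rev_cat. Qed.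

Lemma size_reverse_walk w : size (reverse_walk w) = size w.
Proof. by rewrite size_rev size_map. Qed.

Lemma reduced_reverse w : reduced (reverse_walk w) = reduced w.
Proof.
rewrite /reduced /reverse_walk rev_sorted sorted_map.
by apply: eq_sorted => e f; rewrite /= /onward flipK eq_sym.
Qed.

Lemma walk_cat x y z u v : walk x u y -> walk y v z -> walk x (u ++ v) z.
Proof.
by elim: u x => [|e u IH] x /= => [/eqP-> //|/and3P[-> -> wu] wv /=]; apply: IH.
Qed.

Lemma walk_catP x z u v :
  walk x (u ++ v) z -> exists2 y, walk x u y & walk y v z.
Proof.
elim: u x => [|e u IH] x /=; first by exists x.
by case/and3P=> -> -> /IH[y wu wv]; exists y.
Qed.

Lemma walk_reverse x y w :
  symmetric adj -> walk x w y -> walk y (reverse_walk w) x.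
Proof.
move=> symA; elim: w x => [|e w IH] x /=; first by rewrite eq_sym.
case/and3P=> /eqP <- ae /IH wy.
rewrite /reverse_walk /= rev_cons -cats1; apply: walk_cat wy _.
by rewrite /= !eqxx symA ae.
Qed.

Lemma walk_path x y w : walk x w y -> path adj x (map snd w).
Proof.
elim: w x => [|e w IH] x //= /and3P[/eqP <- ae /IH].
by rewrite ae.
Qed.

Lemma walk_last x y w : walk x w y -> last x (map snd w) = y.
Proof. by elim: w x => [|e w IH] x /= => [/eqP|/and3P[_ _ /IH]]. Qed.

Lemma reduced_cons e w : reduced (e :: w) -> reduced w.
Proof. exact: path_sorted. Qed.

Hypothesis treeV : is_tree adj.

Let symA : symmetric adj. Proof. by case: treeV. Qed.
Let irrA : irreflexive adj. Proof. by case: treeV. Qed.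

(** The part of a walk between two visits to the same vertex contains a cycle,
    which a tree allows only if it runs along one edge back and forth; a reduced
    walk never does. *)
Lemma reduced_walk_uniq x y w :
  walk x w y -> reduced w -> uniq (x :: map snd w).
Proof.
elim: w x => [|e w IH] x //= /and3P[/eqP ex ae ww] red.
have /= /andP[e2w uw] := IH _ ww (reduced_cons red).
rewrite e2w uw !andbT; apply/negP; rewrite in_cons => /orP[/eqP xe2|xw].
  by move: ae; rewrite ex xe2 irrA.
move: (walk_path ww) uw e2w; case/splitPr def_w: _ / xw => [p1 p2] pw uw e2w.
move: pw uw e2w.
rewrite cat_path /= cat_uniq mem_cat => /and3P[pp1 lx _].
case/and3P=> up1 np2 _; rewrite negb_or => /andP[e2p1 _].
have [_ _ _ _ /(_ (x :: e.2 :: p1))] := treeV.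
rewrite /ucycle /= rcons_path pp1 lx -{1}ex ae e2p1 up1 in_cons !negb_or.
have -> : x != e.2 by apply/eqP => xe2; move: ae; rewrite ex xe2 irrA.
have -> : x \notin p1.
  by apply: contra np2 => xp1; apply/hasP; exists x; rewrite // mem_head.
move=> /(_ isT); case: p1 def_w {pp1 lx up1 np2 e2p1} => // def_w _.
case: w def_w red ww {IH} => // f w [fx _] /= /andP[/eqP of_ _].
case/andP=> /eqP f1 _; apply: of_.
by rewrite /flip ex -f1 -fx -surjective_pairing.
Qed.

Lemma closed_reduced_walk x w : walk x w x -> reduced w -> w = [::].
Proof.
move=> wx /(reduced_walk_uniq wx); have := walk_last wx.
by case: w {wx} => //= e w <-; rewrite mem_last.
Qed.

Lemma reduced_join u v :
  reduced u -> reduced v ->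
  (forall e f u' v', u = e :: u' -> v = f :: v' -> e != f) ->
  reduced (reverse_walk u ++ v).
Proof.
case: v => [|f v]; first by rewrite cats0 reduced_reverse.
case: u => [|e u] ru rv dif //.
move: ru; rewrite -reduced_reverse /reverse_walk /= rev_cons => ru.
rewrite cat_rcons /reduced sorted_cat_cons -[sorted _ _]/(reduced _) ru /=.
by rewrite [path _ _ _]rv andbT /onward flipK eq_sym (dif e f u v).
Qed.

(** Two different reduced walks with the same ends, stripped of their common
    beginning, would join up to a closed reduced walk. *)
Lemma reduced_walk_unique x y u v :
  walk x u y -> reduced u -> walk x v y -> reduced v -> u = v.
Proof.
elim: u x v => [|e u IH] x v.
  by move=> /= /eqP <- _ wv rv; rewrite (closed_reduced_walk wv rv).
case: v => [|f v] wu ru wv rv.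
  by move: wu; rewrite -(eqP wv) => /closed_reduced_walk ->.
have [ef|nef] := eqVneq e f.
  case/and3P: wu => _ _ wu; case/and3P: wv => _ _; rewrite -{1}ef => wv.
  by rewrite ef (IH _ _ wu (reduced_cons ru) wv (reduced_cons rv)).
have := closed_reduced_walk (walk_cat (walk_reverse symA wu) wv).
have -> : reduced (reverse_walk (e :: u) ++ f :: v).
  by apply: reduced_join => // ? ? ? ? [<- _] [<- _].
by move=> /(_ isT)/(congr1 size); rewrite size_cat /= addnS.
Qed.

Lemma reduced_walk_exists x y : exists w, walk x w y && reduced w.
Proof.
have [_ _ _ /(_ x y)[p px <-] _] := treeV.
elim: p x px => [|z p IH] x /=; first by exists [::]; rewrite /= eqxx.
case/andP=> axz /IH[w /andP[ww rw]].
have [[w' def_w]|nback] := pselect (exists w', w = (z, x) :: w').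
  exists w'; rewrite def_w in ww rw.
  by case/and3P: ww => _ _ ww; rewrite [walk _ _ _]ww (reduced_cons rw).
exists ((x, z) :: w); rewrite /= eqxx axz ww /=.
case: w {ww} rw nback => //= f w rw nback.
by rewrite rw andbT /onward; apply/eqP => def_f; apply: nback; exists w; rewrite def_f.
Qed.

Definition geod x y : seq (V * V) := sval (cid (reduced_walk_exists x y)).

Lemma geodP x y : walk x (geod x y) y /\ reduced (geod x y).
Proof. by rewrite /geod; case: cid => w /= /andP. Qed.

Lemma geod_unique x y w : walk x w y -> reduced w -> geod x y = w.
Proof. by have [wg rg] := geodP x y; apply: reduced_walk_unique. Qed.

Lemma geod_sym x y : geod y x = reverse_walk (geod x y).
Proof.
have [wg rg] := geodP x y.
by apply: geod_unique; rewrite ?reduced_reverse // walk_reverse.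
Qed.

(** The geodesics from y to x and to z agree up to the centre of the triangle
    x, y, z, and beyond it they form the geodesic from x to z. *)
Lemma tripod x y z : exists p q r,
  [/\ geod x y = p ++ q, geod y z = reverse_walk q ++ r & geod x z = p ++ r].
Proof.
have [] := geodP y z; have [] := geodP y x; rewrite (geod_sym y x).
move: (geod y x) (geod y z) => u v.
elim: u v y => [|e u IH] v y.
  move=> wx _ wz rv; exists [::], [::], v; split=> //.
  by apply: geod_unique; rewrite // -(eqP wx).
case: v => [|f v] wu ru wv rv.
  exists (reverse_walk (e :: u)), [::], [::]; split=> //; first by rewrite cats0.
  rewrite cats0; apply: geod_unique; rewrite ?reduced_reverse //.
  by rewrite -(eqP wv) walk_reverse.
have [ef|nef] := eqVneq e f; last first.
  exists (reverse_walk (e :: u)), [::], (f :: v); split; rewrite ?cats0 //.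
  apply: geod_unique; first by apply: walk_cat (walk_reverse symA wu) wv.
  by apply: reduced_join => // ? ? ? ? [<- _] [<- _].
subst f; case/and3P: wu => e1 _ wu; case/and3P: wv => _ _ wv.
have [p [q [r [def_u def_v def_xz]]]] :=
  IH _ _ wu (reduced_cons ru) wv (reduced_cons rv).
exists p, (rcons q (flip e)), r; split=> //.
  by rewrite /reverse_walk /= rev_cons -[rev _]/(reverse_walk u) def_u rcons_cat.
by rewrite /reverse_walk map_rcons rev_rcons flipK def_v.
Qed.

Lemma size_geod_adj x y z : adj y z -> size (geod x z) <= (size (geod x y)).+1.
Proof.
move=> ayz; have [p [q [r [-> Eyz ->]]]] := tripod x y z.
suff : size (geod y z) = 1%N.
  by rewrite Eyz !size_cat size_reverse_walk; lia.
by rewrite (@geod_unique _ _ [:: (y, z)]) //= !eqxx ayz.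
Qed.

End Walks.

(** * Disjoint copies of a pattern in a word *)

Section Packing.
Local Open Scope nat_scope.
Variables (T : Type) (M : seq T -> Prop).

Inductive packing : seq T -> nat -> Prop :=
| packing0 w : packing w 0
| packingS u s w k : M s -> packing w k -> packing (u ++ s ++ w) k.+1.

Lemma packing_catl t w k : packing w k -> packing (t ++ w) k.
Proof. by case=> [|u s v j Ms pv]; rewrite ?catA -?(catA (t ++ u)); constructor. Qed.

Lemma packing_cat u v i j :
  packing u i -> packing v j -> packing (u ++ v) (i + j).
Proof.
move=> pu pv; elim: pu => [w|u' s w k Ms _ IH]; first exact: packing_catl.
by rewrite -!catA addSn; constructor.
Qed.

(** Cutting a word destroys at most one of the disjoint copies, the one that
    straddles the cut. *)
Lemma packing_split u v k : packing (u ++ v) k ->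
  exists i j, [/\ packing u i, packing v j & k <= i + j + 1].
Proof.
move: {2 3}(u ++ v) (erefl (u ++ v)) => w def_w pw.
elim: pw u def_w => {w k} [w|a s w k Ms pw IH] u def_w.
  by exists 0, 0; split=> //; constructor.
have [le_as|lt_as] := leqP (size (a ++ s)) (size u).
  have def_u : u = (a ++ s) ++ drop (size (a ++ s)) u.
    rewrite -[LHS](cat_take_drop (size (a ++ s))); congr (_ ++ _).
    by rewrite -(takel_cat v le_as) def_w catA take_size_cat.
  move: def_w; rewrite def_u -!catA => /(f_equal (drop (size a))).
  rewrite !drop_size_cat // => /(f_equal (drop (size s))).
  rewrite !drop_size_cat // => /IH[i [j [pi pj le_k]]].
  by exists i.+1, j; split; [constructor | | lia].
exists 0, k; split; [by constructor| |by rewrite add0n addn1].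
have -> : v = drop (size u) (a ++ s) ++ w; last exact: packing_catl.
have := congr1 (drop (size u)) def_w.
by rewrite drop_size_cat // catA drop_cat lt_as.
Qed.

Hypothesis M_gt0 : forall s, M s -> 0 < size s.

Lemma packing_size w k : packing w k -> k <= size w.
Proof.
elim=> [|u s v j Ms _ IH]; rewrite ?leq0n // !size_cat.
by have := M_gt0 Ms; lia.
Qed.

Definition packing_number w := \max_(k < (size w).+1 | `[< packing w k >]) k.

Lemma packing_le w k : packing w k -> k <= packing_number w.
Proof.
move=> pk; have kw : k < (size w).+1 by rewrite ltnS packing_size.
rewrite /packing_number (@leq_bigmax_cond _ _ (@nat_of_ord _) (Ordinal kw)) //.
exact/asboolP.
Qed.

Lemma packing_attained w : packing w (packing_number w).
Proof.
rewrite /packing_number.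
have [|k /asboolP pk ->] :=
  @eq_bigmax_cond 'I_(size w).+1 (fun k => `[< packing w k >]) (@nat_of_ord _).
  by apply/card_gt0P; exists ord0; apply/asboolP; constructor.
exact: pk.
Qed.

Lemma packing_number_cat u v :
  packing_number u + packing_number v <= packing_number (u ++ v)
    <= packing_number u + packing_number v + 1.
Proof.
apply/andP; split; first by apply: packing_le; apply: packing_cat; apply: packing_attained.
have [i [j [pi pj]]] := packing_split (packing_attained (u ++ v)).
by move=> /leq_trans; apply; rewrite leq_add2r leq_add ?packing_le.
Qed.

Lemma packing_map (f : T -> T) w k :
  (forall s, M s -> M (map f s)) -> packing w k -> packing (map f w) k.
Proof.
move=> fM; elim=> [|u s v j Ms _ IH]; first by constructor.
by rewrite !map_cat; constructor; auto.
Qed.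

Lemma packing_number_eq0 w :
  (forall u s v, w = u ++ s ++ v -> ~ M s) -> packing_number w = 0.
Proof.
move=> noM; have := packing_attained w; case def_k: packing_number => [//|k].
move E: k.+1 => j pw; case: pw noM E => // u s v i Ms _ noM _.
by case: (noM u s v).
Qed.

End Packing.

(** * Commutator length *)

Section CommutatorLength.
Local Open Scope nat_scope.
Variable G : groupType.
Implicit Types a b g h : G.

Lemma leastP (P : nat -> Prop) :
  (exists n, P n) -> P (least P) /\ forall m, P m -> least P <= m.
Proof.
move=> exP; have exPb : exists n, `[< P n >].
  by case: exP => n Pn; exists n; apply/asboolP.
apply: (xgetPex 0 (P := fun n => P n /\ forall m, P m -> n <= m)).
exists (ex_minn exPb); case: ex_minnP => n /asboolP Pn minn; split=> // m Pm.
exact/minn/asboolP.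
Qed.

Lemma commutator_productM m n a b : commutator_product m a ->
  commutator_product n b -> commutator_product (m + n) (a * b)%g.
Proof.
case=> s <- -> [t <- ->]; exists (s ++ t); first by rewrite size_cat.
by rewrite big_cat.
Qed.

Lemma commutator_product1 a b : commutator_product 1 [~ a, b]%g.
Proof. by exists [:: (a, b)]; rewrite ?big_seq1. Qed.

Lemma in_commutator_subgroupM a b : in_commutator_subgroup a ->
  in_commutator_subgroup b -> in_commutator_subgroup (a * b)%g.
Proof. by case=> m ma [n nb]; exists (m + n); apply: commutator_productM. Qed.

Lemma in_commutator_subgroupX a n :
  in_commutator_subgroup a -> in_commutator_subgroup (a ^+ n)%g.
Proof.
move=> ca; elim: n => [|n IH]; last by rewrite expgS; apply: in_commutator_subgroupM.
by exists 0, [::]; rewrite ?big_nil ?expg0.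
Qed.

Lemma cl_attained a :
  in_commutator_subgroup a -> commutator_product (cl a) a.
Proof. by move=> /leastP[]. Qed.

Lemma cl_le n a : commutator_product n a -> cl a <= n.
Proof.
move=> na; have [_] := leastP (ex_intro (fun n => commutator_product n a) n na).
exact.
Qed.

Lemma clM a b : in_commutator_subgroup a -> in_commutator_subgroup b ->
  cl (a * b)%g <= cl a + cl b.
Proof.
by move=> ca cb; apply/cl_le/commutator_productM; apply: cl_attained.
Qed.

(** The four letters of a commutator are a, b and their inverses, on which f
    sums to 0; what remains is one defect for each of the 4n - 1 products. *)
Lemma quasimorphism_commutator_product (f : G -> int) (D : int) n g :
  (forall a b, f (a * b)%g <= f a + f b + D)%R ->
  (forall a, f a^-1%g = - f a)%R ->
  commutator_product n g -> (f g <= 4 * D * n%:Z)%R.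
Proof.
move=> fM fV [s <- ->]; elim: s => [|[a b] s IH].
  by have := fV 1%g; rewrite big_nil mulr0 invg1; move: (f 1%g) => z; lia.
rewrite big_cons /=; set r := (\prod_(p <- s) _)%g in IH *.
have := fM [~ a, b]%g r; rewrite {2}/commg /conjg.
have := fM a^-1%g (b^-1 * (a * b))%g; have := fM b^-1%g (a * b)%g.
have := fM a b; rewrite !fV.
move: (f _) (f _) (f _) (f _) (f _) (f _) (f _) IH => z1 z2 z3 z4 z5 z6 z7 IH.
lia.
Qed.

(** If h inverts g, then an even power of g is a single commutator with h. *)
Lemma inverted_even_power g h j :
  (g ^ h)%g = g^-1%g -> (g ^+ (j + j))%g = [~ g ^- j, h]%g.
Proof.
by move=> gh; rewrite commgEl conjVg conjXg gh invgK expVgn invgK expgnDr.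
Qed.

(** By an odd power one passes to the even power below it, at the price of one
    factor g, which then lies in the commutator subgroup too. *)
Lemma inverted_cl_power g h m : (g ^ h)%g = g^-1%g ->
  in_commutator_subgroup (g ^+ m)%g -> cl (g ^+ m)%g <= cl g + 1.
Proof.
move=> gh cm; pose j := m./2.
have c1 a : (a ^ h)%g = a^-1%g -> commutator_product 1 (a ^+ (j + j))%g.
  by move/inverted_even_power->; apply: commutator_product1.
have [odd_m|even_m] := boolP (odd m); last first.
  rewrite -(even_halfK even_m) -addnn.
  by apply: leq_trans (leq_addl _ _); apply/cl_le/c1.
have def_m : m = (j + j).+1.
  by rewrite addnn -[LHS]odd_double_half odd_m.
rewrite def_m expgS; rewrite def_m expgS in cm.
have cg : in_commutator_subgroup g.
  rewrite -(mulgK (g ^+ (j + j)) g)%g; apply: in_commutator_subgroupM cm _.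
  exists 1; rewrite -expVgn; apply: c1.
  by rewrite conjVg gh.
by apply/cl_le/commutator_productM; [apply: cl_attained | apply: c1].
Qed.

End CommutatorLength.

(** * Stable commutator length as a limit *)

Section StableCommutatorLength.
Variable R : realType.

Lemma cvg_div_nat (C : R) : (fun n : nat => C / n%:R) @ \oo --> (0 : R).
Proof.
have cvgC : C * harmonic n @[n --> \oo] --> C * 0.
  by apply: cvgM; [exact: cvg_cst | exact: cvg_harmonic].
rewrite mulr0 in cvgC.
have <- := cvg_shiftS (fun n : nat => C / n%:R) (nbhs (0 : R)).
exact: cvgC.
Qed.

(** Fekete's lemma: writing n = q m + r with r < m bounds a n / n by a m / m
    up to an error of order 1 / n, so the limit is the infimum. *)
Lemma subadditive_cvg (a : nat -> R) :
  (forall n, 0 <= a n) -> (forall m n, a (m + n)%N <= a m + a n) ->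
  cvgn (fun n => a n / n%:R).
Proof.
move=> a_ge0 aD; pose E : set R := [set a n.+1 / n.+1%:R | n in setT]%classic.
have E_ge0 : lbound E 0.
  by move=> _ [n _ <-]; rewrite divr_ge0.
have E_lb : has_lbound E by exists 0.
have E_inf : has_inf E by split=> //; exists (a 1%N / 1%:R), 0%N.
suff : (fun n => a n / n%:R) @ \oo --> inf E by apply: cvgP.
apply/cvgrPdist_le => e e_gt0.
have e2_gt0 : 0 < e / 2 by rewrite divr_gt0.
have [_ [m' _ <-] lt_m] := inf_adherent e2_gt0 E_inf.
(* C bounds the value of a at every remainder modulo m. *)
set m := m'.+1 in lt_m; pose C := \sum_(r < m) a r.
have le_rem q r : a (q * m + r)%N <= q%:R * a m + a r.
  elim: q => [|q IH]; first by rewrite mul0r add0r.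
  rewrite mulSn -addnA -natr1; have := aD m (q * m + r)%N; lra.
have le_C r : (r < m)%N -> a r <= C.
  by move=> rm; rewrite /C (bigD1 (Ordinal rm)) //= lerDl sumr_ge0.
have := cvg_div_nat C; move/cvgrPdist_le => /(_ _ e2_gt0).
apply: filterS2 (nbhs_infty_gt 0) => n n_gt0.
have nR : 0 < n%:R :> R by rewrite ltr0n.
have C_ge0 : 0 <= C by apply: sumr_ge0.
rewrite sub0r normrN ger0_norm ?divr_ge0 // => le_Cn.
have lb : inf E <= a n / n%:R.
  by apply: ge_inf => //; exists n.-1; rewrite ?prednK.
rewrite ler0_norm ?subr_le0 // opprB lerBlDr.
have : a n / n%:R <= a m / m%:R + C / n%:R; last by move: lt_m; lra.
rewrite ler_pdivrMr // mulrDl divfK ?gt_eqF //.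
rewrite {1}(divn_eq n m); apply: le_trans (le_rem _ _) _.
apply: lerD; last by rewrite le_C // ltn_mod.
rewrite mulrC -mulrA ler_wpM2l // mulrC ler_pdivlMr ?ltr0n //.
by rewrite -natrM ler_nat leq_divM.
Qed.

Variable G : groupType.
Implicit Type g : G.

Lemma scl_lim_cvg g : in_commutator_subgroup g ->
  cvgn (fun n => (cl (g ^+ n)%g)%:R / n%:R : R).
Proof.
move=> cg; apply: subadditive_cvg => // m n.
by rewrite -natrD ler_nat expgnDr clM //; apply: in_commutator_subgroupX.
Qed.

(** The error C disappears in the limit. *)
Lemma scl_ge g (c C : R) :
  (forall m, in_commutator_subgroup (g ^+ m)%g ->
     c * m%:R - C <= (cl (g ^+ m)%g)%:R) ->
  (c%:E <= scl R g)%E.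
Proof.
move=> lb; rewrite /scl; case: asboolP => [/leastP|_]; last exact: leey.
set k := least _ => -[[k_gt0 ck] _].
rewrite lee_fin ler_pdivlMr ?ltr0n //; apply/ler_addgt0Pr => e e_gt0.
rewrite -lerBlDr; apply: limr_ge; first exact: scl_lim_cvg.
have := cvg_div_nat C; move/cvgrPdist_le => /(_ e e_gt0).
apply: filterS2 (nbhs_infty_gt 0) => n n_gt0.
have nR : 0 < n%:R :> R by rewrite ltr0n.
rewrite sub0r normrN => /(le_trans (ler_norm _)); rewrite !ler_pdivrMr // => le_e.
rewrite ler_pdivlMr // -expgnA; apply: le_trans (lb _ _); last first.
  by rewrite expgnA; apply: in_commutator_subgroupX.
by rewrite natrM mulrBl mulrA lerB.
Qed.

Lemma scl_eq0 g (B : nat) :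
  (exists k, (0 < k)%N /\ in_commutator_subgroup (g ^+ k)%g) ->
  (forall m, in_commutator_subgroup (g ^+ m)%g -> (cl (g ^+ m)%g <= B)%N) ->
  scl R g = 0%E.
Proof.
move=> exk ub; rewrite /scl; case: asboolP => // /leastP.
set k := least _ => -[[k_gt0 ck] _].
suff -> : scl_lim R (g ^+ k)%g = 0 by rewrite mul0r.
apply: cvg_lim => //; apply: squeeze_cvgr (cvg_div_nat B%:R); last exact: cvg_cst.
apply: nearW => n; rewrite divr_ge0 //= ler_wpM2r ?invr_ge0 // ler_nat.
by rewrite -expgnA ub // expgnA; apply: in_commutator_subgroupX.
Qed.

Lemma inverted_scl_eq0 g h : (g ^ h)%g = (g^-1)%g -> scl R g = 0%E.
Proof.
move=> gh; apply: (@scl_eq0 _ (cl g + 1)).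
  by exists 2%N; split=> //; exists 1%N; rewrite (inverted_even_power 1 gh);
     apply: commutator_product1.
by move=> m; apply: inverted_cl_power gh.
Qed.

End StableCommutatorLength.

(** * Rays in a tree *)

Section Rays.
Local Open Scope nat_scope.
Variables (V : eqType) (adj : rel V) (A : nat -> V).

Definition stretch i n : seq (V * V) := [seq (A j, A j.+1) | j <- iota i n].

Lemma stretchD i m n : stretch i (m + n) = stretch i m ++ stretch (i + m) n.
Proof. by rewrite /stretch iotaD map_cat. Qed.

Lemma size_stretch i n : size (stretch i n) = n.
Proof. by rewrite size_map size_iota. Qed.

Hypothesis adjA : forall i, adj (A i) (A i.+1).
Hypothesis nonbacktracking : forall i, A i <> A i.+2.

Lemma walk_stretch i n : walk adj (A i) (stretch i n) (A (i + n)).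
Proof.
elim: n i => [|n IH] i /=; first by rewrite addn0.
by rewrite eqxx adjA -addSnnS IH.
Qed.

Lemma reduced_stretch i n : reduced (stretch i n).
Proof.
case: n => // n; rewrite /reduced /stretch /=.
elim: n i => //= n IH i; rewrite IH andbT.
by apply/eqP => -[] /esym/nonbacktracking.
Qed.

(** Being reduced is a local condition, so a path that nowhere turns back is
    globally a geodesic. *)
Lemma geod_ray (treeV : is_tree adj) i n :
  geod treeV (A i) (A (i + n)) = stretch i n.
Proof. by apply: geod_unique; [exact: walk_stretch | exact: reduced_stretch]. Qed.

End Rays.

(** * Metric geometry of the realization *)

Section Realization.
Variables (R : realType) (V : eqType) (adj : rel V).
Implicit Types (u v : V) (x y : V -> R) (r s t l : R).

Lemma edge_point_source u v v' :
  edge_point u v 0 = edge_point u v' 0 :> (V -> R).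
Proof. by apply: funext => w; rewrite /edge_point !mul0r. Qed.

Lemma edge_point_target u v w :
  edge_point u v 1 = edge_point v w 0 :> (V -> R).
Proof.
by apply: funext => z; rewrite /edge_point subrr subr0 !mul0r !mul1r addrC.
Qed.

Lemma realization_edge u v t : adj u v -> 0 <= t <= 1 ->
  realization adj (edge_point u v t).
Proof. by move=> auv t01; exists u, v, t; split=> //; right. Qed.

Lemma realization_vertex v : realization adj (edge_point v v (0 : R)).
Proof. by exists v, v, 0; split; rewrite ?lexx ?ler01 //; left. Qed.

Lemma string_edge u v s t : adj u v -> 0 <= s <= 1 -> 0 <= t <= 1 ->
  string adj (edge_point u v s) (edge_point u v t) `|s - t|.
Proof.
move=> auv s01 t01; rewrite -[`|_|]addr0.
by apply: string_cons => //; apply/string_nil/realization_edge.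
Qed.

Lemma string_cat x y z l l' :
  string adj x y l -> string adj y z l' -> string adj x z (l + l').
Proof.
move=> sxy syz; elim: sxy syz => [w _|u v s t w k auv s01 t01 _ IH] syz.
  by rewrite add0r.
by rewrite -addrA; apply: string_cons => //; apply: IH.
Qed.

Lemma string_sym x y l : string adj x y l -> string adj y x l.
Proof.
elim=> [w rw|u v s t w k auv s01 t01 _ IH]; first exact: string_nil.
rewrite addrC; apply: string_cat IH _.
by rewrite distrC; apply: string_edge.
Qed.

Lemma string_ge0 x y l : string adj x y l -> 0 <= l.
Proof. by elim=> // *; rewrite addr_ge0. Qed.

Lemma tree_dist_ge0 x y : 0 <= tree_dist adj x y.
Proof.
rewrite /tree_dist; set E := [set l | string adj x y l].
have [->|/set0P E0] := eqVneq E set0; first by rewrite inf0.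
by apply: lb_le_inf => // l; apply: string_ge0.
Qed.

Lemma tree_dist_le x y l : string adj x y l -> tree_dist adj x y <= l.
Proof.
by move=> sl; apply: ge_inf => //; exists 0 => k; apply: string_ge0.
Qed.

Lemma tree_dist_sym x y : tree_dist adj x y = tree_dist adj y x.
Proof.
by rewrite /tree_dist; congr inf; apply/seteqP; split=> l; apply: string_sym.
Qed.

Lemma edge_point_sum (b : V -> R) (ws : seq V) u v t :
  uniq ws -> u \in ws -> v \in ws ->
  \sum_(w <- ws) edge_point u v t w * b w = (1 - t) * b u + t * b v.
Proof.
move=> uws uw vw.
have pick r z : z \in ws -> \sum_(w <- ws) r * (w == z)%:R * b w = r * b z.
  move=> zw; rewrite (bigD1_seq z) //= eqxx mulr1 big1 ?addr0 // => w /negPf->.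
  by rewrite mulr0 mul0r.
by under eq_bigr do rewrite mulrDl; rewrite big_split /= !pick.
Qed.

(** The affine extension of a function on the vertices depends on the point
    only, not on the edge through which the point is presented. *)
Lemma edge_point_affine (b : V -> R) u v t u' v' t' :
  edge_point u v t = edge_point u' v' t' ->
  (1 - t) * b u + t * b v = (1 - t') * b u' + t' * b v'.
Proof.
move=> E; pose ws := undup [:: u; v; u'; v'].
have in_ws w : w \in [:: u; v; u'; v'] -> w \in ws by rewrite mem_undup.
rewrite -!(@edge_point_sum b ws) ?undup_uniq ?E // in_ws // !inE !eqxx ?orbT //.
Qed.

Lemma string_height (b : V -> R) x y l :
  (forall u v, adj u v -> `|b u - b v| <= 1) ->
  string adj x y l -> forall u v s u' v' s',
  x = edge_point u v s -> y = edge_point u' v' s' ->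
  `|((1 - s) * b u + s * b v) - ((1 - s') * b u' + s' * b v')| <= l.
Proof.
move=> b_lip; elim=> [w _|p q a c w k apq a01 c01 _ IH] u v s u' v' s'.
  by move=> -> /(edge_point_affine b) ->; rewrite subrr normr0.
move=> /(edge_point_affine b) <- /(IH _ _ _ _ _ _ erefl) le_k.
apply: le_trans (ler_distD ((1 - c) * b p + c * b q) _ _) _.
apply: lerD le_k.
have -> : (1 - a) * b p + a * b q - ((1 - c) * b p + c * b q) =
          (a - c) * (b q - b p) by lra.
by rewrite normrM ler_piMr // distrC b_lip.
Qed.

Lemma string_walk v w z : walk adj v w z ->
  string adj (edge_point v v 0) (edge_point z z 0) ((size w)%:R : R).
Proof.
elim: w v => [|[p q] w IH] v /= => [/eqP->|/and3P[/eqP<- apq /IH swz]].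
  exact/string_nil/realization_vertex.
rewrite -natr1 addrC; apply: string_cat swz.
rewrite (edge_point_source p p q) -(edge_point_target p q q).
have := @string_edge p q 0 1 apq; rewrite sub0r normrN1; apply.
  by rewrite lexx ler01.
by rewrite lexx ler01.
Qed.

End Realization.

Section Action.
Variables (R : realType) (G : groupType) (V : eqType) (adj : rel V).
Variable act : G -> V -> V.
Hypothesis actP : is_simplicial_action adj act.

Lemma act1 v : act 1%g v = v. Proof. by case: actP. Qed.

Lemma actM g h v : act (g * h)%g v = act g (act h v).
Proof. by case: actP. Qed.

Lemma act_adj g u v : adj (act g u) (act g v) = adj u v.
Proof. by case: actP. Qed.

Lemma actK g : cancel (act g) (act g^-1%g).
Proof. by move=> v; rewrite -actM mulVg act1. Qed.

Lemma actVK g : cancel (act g^-1%g) (act g).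
Proof. by move=> v; rewrite -actM mulgV act1. Qed.

Lemma act_inj g : injective (act g). Proof. exact: can_inj (actK g). Qed.

Lemma act_eq g u v : (act g u == act g v) = (u == v).
Proof. exact/inj_eq/act_inj. Qed.

Lemma point_act_edge_point g u v (t : R) :
  point_act act g (edge_point u v t) = edge_point (act g u) (act g v) t.
Proof.
have act_eqV w z : (act g^-1%g w == z) = (w == act g z).
  by rewrite -(act_eq g) actVK.
by apply: funext => w; rewrite /point_act /edge_point !act_eqV.
Qed.

Lemma translation_length_le g v w :
  walk adj v w (act g v) -> translation_length R adj act g <= (size w)%:R.
Proof.
move=> wv; apply: (@le_trans _ _ (tree_dist adj (edge_point v v (0 : R))
  (point_act act g (edge_point v v 0)))).
  apply: ge_inf; first by exists 0 => _ [x _ <-]; apply: tree_dist_ge0.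
  by exists (edge_point v v 0) => //; apply: realization_vertex.
by rewrite point_act_edge_point; apply/tree_dist_le/string_walk.
Qed.

Lemma hyperbolic_no_fixpoint g v : hyperbolic R adj act g -> act g v <> v.
Proof.
move=> hg gv; have := @translation_length_le g v [::]; rewrite /= gv eqxx.
by move=> /(_ isT); rewrite leNgt -/(hyperbolic R adj act g) hg.
Qed.

Variable K : R.
Hypothesis acyl : acylindrical adj act K.
Hypothesis treeV : is_tree adj.

Variable A : nat -> V.
Hypothesis adjA : forall i, adj (A i) (A i.+1).
Hypothesis nonbacktracking : forall i, A i <> A i.+2.

Let height v : R := (size (geod treeV (A 0) v))%:R.

Let height_ray i : height (A i) = i%:R.
Proof. by rewrite /height -[i]add0n geod_ray // size_stretch. Qed.

Let height_lipschitz u v : adj u v -> `|height u - height v| <= 1.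
Proof.
move=> auv; have symA : symmetric adj by case: treeV.
have := size_geod_adj treeV (A 0) auv.
have := @size_geod_adj _ _ treeV (A 0) v u; rewrite symA => /(_ auv).
rewrite -!(ler_nat R) -!natr1 -!/(height _) ler_norml; lra.
Qed.

Definition ray_point (s : R) : V -> R :=
  edge_point (A (Num.truncn s)) (A (Num.truncn s).+1) (s - (Num.truncn s)%:R).

Let frac_itv (s : R) : 0 <= s -> 0 <= s - (Num.truncn s)%:R <= 1.
Proof. by move/truncn_itv; rewrite -natr1; lra. Qed.

Let string_ray i j (a b : R) : 0 <= a <= 1 -> 0 <= b <= 1 -> (j = 0%N -> a <= b) ->
  string adj (edge_point (A i) (A i.+1) a)
    (edge_point (A (i + j)) (A (i + j).+1) b) (j%:R + b - a).
Proof.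
elim: j i a => [|j IH] i a a01 b01 jab.
  rewrite addn0 add0r -(@ger0_norm _ (b - a)) ?subr_ge0 ?jab // distrC.
  exact: string_edge.
have -> : j.+1%:R + b - a = `|a - 1| + (j%:R + b - 0).
  by rewrite -natr1 ler0_norm; [lra | case/andP: a01; lra].
apply: string_cons; rewrite ?ler01 ?lexx //.
rewrite (edge_point_target _ _ _ (A i.+2)) -addSnnS.
by apply: IH; rewrite ?lexx ?ler01 // => _; case/andP: b01.
Qed.

(** The distance cannot drop below the difference of the heights, since the
    distance to the origin of the ray is 1-Lipschitz on vertices. *)
Lemma tree_dist_ray s t : 0 <= s -> 0 <= t ->
  tree_dist adj (ray_point s) (ray_point t) = `|s - t|.
Proof.
wlog le_st : s t / s <= t => [hw|] s0 t0.
  have [st|/ltW ts] := leP s t; first exact: hw.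
  by rewrite tree_dist_sym distrC hw.
have le_tr : (Num.truncn s <= Num.truncn t)%N by apply: le_truncn.
have s_st : string adj (ray_point s) (ray_point t) `|s - t|.
  have := @string_ray (Num.truncn s) (Num.truncn t - Num.truncn s) _ _ (frac_itv s0) (frac_itv t0).
  rewrite subnKC // natrB // ler0_norm ?subr_le0 //.
  have -> : (Num.truncn t)%:R - (Num.truncn s)%:R + (t - (Num.truncn t)%:R) -
            (s - (Num.truncn s)%:R) = - (s - t) by lra.
  apply=> /eqP; rewrite subn_eq0 => le_ts.
  have -> : Num.truncn t = Num.truncn s by apply/eqP; rewrite eqn_leq le_ts.
  by rewrite lerB.
apply/eqP; rewrite eq_le tree_dist_le //=.
apply: lb_le_inf; first by exists `|s - t|.
move=> l /(string_height height_lipschitz)/(_ _ _ _ _ _ _ erefl erefl).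
rewrite !height_ray -!natr1.
by congr (`|_| <= _); lra.
Qed.

(** An element that fixes the first L edges of the ray fixes a segment of
    length K. *)
Lemma acylindrical_ray L h : K <= L%:R ->
  (forall i, (i <= L)%N -> act h (A i) = A i) -> h = 1%g.
Proof.
move=> KL fixA; apply: (acyl (S := ray_point @` `[0, K]%classic)).
  exists ray_point; split=> //.
    move=> _ [s /= /[!in_itv]/= /andP[s0 _] <-].
    exact: realization_edge (frac_itv s0).
  by move=> s t /andP[s0 _] /andP[t0 _]; apply: tree_dist_ray.
move=> _ [s /= /[!in_itv]/= /andP[s0 sK] <-].
rewrite /ray_point point_act_edge_point.
have /andP[le_s _] := truncn_itv s0.
have le_sL : (Num.truncn s)%:R <= L%:R :> R by apply: le_trans le_s (le_trans sK KL).
rewrite ler_nat in le_sL.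
rewrite fixA //; have [lt_sL|le_Ls] := ltnP (Num.truncn s) L; first by rewrite fixA.
(* Only the last vertex of the segment can be reached here, with s = K = L. *)
have -> : s - (Num.truncn s)%:R = 0; last exact: edge_point_source.
apply/eqP; rewrite subr_eq0 eq_le le_s andbT (le_trans sK) // (le_trans KL) //.
by rewrite ler_nat.
Qed.

End Action.

(** * The axis of a hyperbolic element *)

Section Axis.
Local Open Scope nat_scope.
Variables (G : groupType) (V : eqType) (adj : rel V) (act : G -> V -> V).
Hypothesis actP : is_simplicial_action adj act.
Hypothesis treeV : is_tree adj.

Definition act_edge g (e : V * V) := (act g e.1, act g e.2).

Lemma walk_act g x w y :
  walk adj (act g x) (map (act_edge g) w) (act g y) = walk adj x w y.
Proof.
elim: w x => [|e w IH] x /=; first by rewrite (act_eq actP).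
by rewrite (act_eq actP) (act_adj actP) IH.
Qed.

Lemma reduced_act g w : reduced (map (act_edge g) w) = reduced w.
Proof.
rewrite /reduced sorted_map; apply: eq_sorted => -[a b] [c d].
by rewrite /= /onward /flip /= !xpair_eqE !(act_eq actP).
Qed.

Lemma geod_act g x y :
  geod treeV (act g x) (act g y) = map (act_edge g) (geod treeV x y).
Proof.
have [wg rg] := geodP treeV x y.
by apply: geod_unique; rewrite ?walk_act ?reduced_act.
Qed.

Lemma reverse_walk_act g w :
  reverse_walk (map (act_edge g) w) = map (act_edge g) (reverse_walk w).
Proof. by rewrite /reverse_walk map_rev -!map_comp. Qed.

Lemma act_edgeM g h w :
  map (act_edge (g * h)%g) w = map (act_edge g) (map (act_edge h) w).
Proof.
by rewrite -map_comp; apply: eq_map => e; rewrite /act_edge /= !(actM actP).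
Qed.

Lemma act_edge1 w : map (act_edge 1%g) w = w.
Proof.
rewrite (eq_map (g := id)) ?map_id // => -[a b].
by rewrite /act_edge /= !(act1 actP).
Qed.

Definition walk_vertex x (w : seq (V * V)) j := nth x (x :: map snd w) j.

Lemma walk_vertex_adj x y w j : walk adj x w y -> j < size w ->
  adj (walk_vertex x w j) (walk_vertex x w j.+1).
Proof.
move=> /walk_path/pathP; rewrite size_map => pw jw.
exact: (pw x j jw).
Qed.

Lemma walk_vertex_neq x y w j : walk adj x w y -> reduced w ->
  j.+1 < size w -> walk_vertex x w j <> walk_vertex x w j.+2.
Proof.
rewrite /walk_vertex; elim: w x y j => [|e w IH] x y j //=.
case: w IH => [|f w] // IH /and3P[/eqP ex _ ww] /= /andP[ef rw].
case: j => [_|j jw].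
  move=> /= xf; move: ef; rewrite /onward.
  case/and3P: ww => /eqP f1 _ _; move: xf f1; rewrite -ex.
  by case: (e) (f) => [a b] [c d] /= -> ->; rewrite eqxx.
have := IH e.2 y j ww rw jw; rewrite /= !(set_nth_default x e.2) //=.
  by rewrite size_map; move: jw; rewrite /= ltnS.
by rewrite size_map; move: jw; rewrite /=; lia.
Qed.

(** At a vertex x moved by g as little as possible, the geodesic u from x to
    g x does not turn back where it meets its translate: otherwise g would move
    the second vertex of u less, or invert u if this is a single edge. *)
Lemma axis_exists g : without_inversions adj act -> (forall v, act g v <> v) ->
  exists A l, [/\ 0 < l, forall i, adj (A i) (A i.+1),
    forall i, A i <> A i.+2 & forall i, A (i + l) = act g (A i)].
Proof.
move=> noinv nofix; have [[x0] _ _ _ _] := treeV.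
have ex_size : exists n, `[< exists x, size (geod treeV x (act g x)) = n >].
  by exists (size (geod treeV x0 (act g x0))); apply/asboolP; exists x0.
case: (ex_minnP ex_size) => l /asboolP[x size_u] min_u.
have {}min_u y : l <= size (geod treeV y (act g y)).
  by apply: min_u; apply/asboolP; exists y.
have [wu ru] := geodP treeV x (act g x).
move: (geod treeV x (act g x)) size_u wu ru => u size_u wu ru.
have l_gt0 : 0 < l.
  by case: u size_u wu {ru} => [_ /eqP/esym/nofix[]|e u <-].
pose w := u ++ map (act_edge g) u.
have ww : walk adj x w (act g (act g x)).
  by apply: (walk_cat wu); rewrite walk_act.
have rw : reduced w.
  (* Only the turn from the last edge of u to the first edge of its translate
     has to be examined. *)
  case def_u: u => [|e u2] in size_u wu ru w ww *.
    by move: l_gt0; rewrite -size_u.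
  have := ru; rewrite -(reduced_act g) /w /reduced /= cat_path /= => ->.
  rewrite [path _ _ _]ru andbT; apply/eqP => -[g1 g2].
  case/and3P: (wu) => /eqP e1 ae wu2.
  move: wu2 ru size_u g1 g2; case/lastP: u2 {def_u w ww wu} => [|u3 f].
    move=> /= /eqP e2 _ _ _ ge; apply: (noinv g e.1 e.2 ae).
    by rewrite ge e1 e2.
  rewrite last_rcons -cats1 => /walk_catP[z w3 /and3P[/eqP fz _ _]] ru.
  rewrite /= size_cat addn1 => size_u _ g2.
  have := min_u e.2; rewrite g2 (geod_unique treeV _ _ (w := u3)).
  - by rewrite -size_u; lia.
  - by rewrite fz.
  - by have [] := cat_sorted2 (reduced_cons ru).
pose vs := walk_vertex x w.
have vs_l j : j < l.+1 -> vs (l + j) = act g (vs j).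
  have vs_l0 : vs l = act g x.
    rewrite /vs /walk_vertex /w -size_u -(walk_last wu) map_cat -cat_cons.
    by rewrite nth_cat /= size_map ltnSn (last_nth x) size_map.
  case: j => [|j] jl; first by rewrite addn0 vs_l0.
  rewrite /vs /walk_vertex addnS /= /w map_cat !nth_cat size_map size_u.
  rewrite ltnNge leq_addr /= addKn -ltnS jl -map_comp.
  by rewrite !(nth_map (x, x)) ?size_u.
pose A i := act (g ^+ (i %/ l))%g (vs (i %% l)).
have A_vs q r : r < l.+2 -> A (q * l + r) = act (g ^+ q)%g (vs r).
  have A_lt p j : j < l -> A (p * l + j) = act (g ^+ p)%g (vs j).
    by move=> jl; rewrite /A divnMDl // modnMDl divn_small // modn_small ?addn0.
  move=> rl; have [|lr] := ltnP r l; first exact: A_lt.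
  have [|ll] := ltnP (r - l) l.
    move/(A_lt q.+1); rewrite mulSn addnAC subnKC // addnC => ->.
    by rewrite expgSr (actM actP) -vs_l ?subnKC //; lia.
  have [-> ->] : r = 2 /\ l = 1 by lia.
  have l1 : l = 1 by lia.
  have := A_lt q.+2 0 l_gt0; rewrite l1 !muln1 !addn0 addn2 => ->.
  rewrite !expgSr !(actM actP) -[vs 2]/(vs (1 + 1)).
  by move: vs_l; rewrite l1 => vs_l; rewrite vs_l // -[vs 1]/(vs (1 + 0)) vs_l.
have size_w : size w = l + l by rewrite size_cat size_map size_u.
exists A, l; split=> // i.
- have il := ltn_pmod i l_gt0; rewrite (divn_eq i l) -addnS.
  rewrite !A_vs ?(act_adj actP); try lia.
  by apply: walk_vertex_adj ww _; lia.
- have il := ltn_pmod i l_gt0; rewrite (divn_eq i l) -!addnS.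
  rewrite !A_vs; try lia.
  by move/(act_inj actP); apply: walk_vertex_neq ww rw _; lia.
- by rewrite /A divnDr // divnn l_gt0 addn1 modnDr expgS (actM actP).
Qed.

End Axis.

(** * The counting quasimorphism *)

Section Counting.
Variables (G : groupType) (V : eqType) (adj : rel V) (act : G -> V -> V).
Hypothesis actP : is_simplicial_action adj act.
Hypothesis treeV : is_tree adj.
Variable pattern : seq (V * V).
Hypothesis pattern_gt0 : (0 < size pattern)%N.

Definition translate (s : seq (V * V)) :=
  exists h, s = map (act_edge act h) pattern.

Lemma translate_gt0 s : translate s -> (0 < size s)%N.
Proof. by case=> h ->; rewrite size_map. Qed.

Lemma translate_act h s : translate s -> translate (map (act_edge act h) s).
Proof. by case=> k ->; exists (h * k)%g; rewrite (act_edgeM actP). Qed.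

Notation copies := (packing_number translate).

Lemma copies_act h w : copies (map (act_edge act h) w) = copies w.
Proof.
have le_h k v : (copies v <= copies (map (act_edge act k) v))%N.
  apply: (packing_le translate_gt0); apply: packing_map; first exact: translate_act.
  exact: packing_attained.
apply/eqP; rewrite eqn_leq le_h andbT.
by have := le_h h^-1%g (map (act_edge act h) w);
   rewrite -(act_edgeM actP) mulVg (act_edge1 actP).
Qed.

Variable x : V.

(** The counting quasimorphism of Brooks and Fujiwara, for the action on a
    tree. *)
Definition counting (a : G) : int :=
  (copies (geod treeV x (act a x)))%:Z -
  (copies (reverse_walk (geod treeV x (act a x))))%:Z.

Lemma countingV a : counting a^-1%g = - counting a.
Proof.
have -> : counting a^-1%g = (copies (geod treeV (act a x) x))%:Z -
    (copies (reverse_walk (geod treeV (act a x) x)))%:Z.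
  rewrite -(copies_act a^-1%g (geod _ _ _)).
  rewrite -(copies_act a^-1%g (reverse_walk _)) -reverse_walk_act.
  by rewrite -(geod_act actP) (actK actP).
by rewrite geod_sym reverse_walkK /counting opprB.
Qed.

(** The three sides of the triangle x, a x, ab x are made of three legs and
    their reverses. The six counts are additive along the legs up to 0 or 1, and
    the counts on the legs cancel. *)
Lemma countingM a b : counting (a * b)%g <= counting a + counting b + 3.
Proof.
have -> : counting b = (copies (geod treeV (act a x) (act (a * b)%g x)))%:Z -
    (copies (reverse_walk (geod treeV (act a x) (act (a * b)%g x))))%:Z.
  by rewrite (actM actP) (geod_act actP) (reverse_walk_act act) !copies_act.
rewrite /counting.
have [p [q [r [-> -> ->]]]] := tripod treeV x (act a x) (act (a * b)%g x).
rewrite !reverse_walk_cat reverse_walkK.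
have cat u v := packing_number_cat translate_gt0 u v.
have := cat p q; have := cat p r; have := cat (reverse_walk q) r.
have := cat (reverse_walk q) (reverse_walk p).
have := cat (reverse_walk r) (reverse_walk p); have := cat (reverse_walk r) q.
lia.
Qed.

Lemma counting_commutator_product n a :
  commutator_product n a -> counting a <= 12 * n%:Z.
Proof. exact: quasimorphism_commutator_product countingM countingV. Qed.

End Counting.

(** * Reversals of the axis *)

Section Gap.
Local Open Scope nat_scope.
Variables (G : groupType) (V : eqType) (adj : rel V) (act : G -> V -> V).
Hypothesis actP : is_simplicial_action adj act.
Hypothesis treeV : is_tree adj.
Variables (g : G) (A : nat -> V) (l N : nat).
Hypothesis adjA : forall i, adj (A i) (A i.+1).
Hypothesis nonbacktracking : forall i, A i <> A i.+2.
Hypothesis shiftA : forall i, A (i + l) = act g (A i).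
Hypothesis l_gt0 : 0 < l.
Hypothesis N_gt0 : 0 < N.

Lemma shift_ray m i : A (i + m * l) = act (g ^+ m)%g (A i).
Proof.
elim: m => [|m IH]; first by rewrite addn0 (act1 actP).
by rewrite mulSn addnCA addnC shiftA IH expgS (actM actP).
Qed.

Lemma stretch_translate m n :
  stretch A (m * l) n = map (act_edge act (g ^+ m)%g) (stretch A 0 n).
Proof.
rewrite /stretch -[m * l]addn0 iotaDl -!map_comp; apply: eq_map => j.
by rewrite /= /act_edge /= -!shift_ray addSn (addnC (m * l)).
Qed.

Lemma stretch_infix n a t b :
  stretch A 0 n = a ++ t ++ b -> t = stretch A (size a) (size t).
Proof.
move=> E; have := congr1 size E; rewrite !size_cat size_stretch => def_n.
move: E; rewrite def_n !stretchD => /eqP.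
rewrite eqseq_cat ?size_stretch // => /andP[_].
by rewrite eqseq_cat ?size_stretch // => /andP[/eqP-> _].
Qed.

Let pattern := stretch A 0 (N * l).

Lemma packing_axis q i r :
  packing (translate act pattern) (stretch A (i * l) (q * (N * l) + r)) q.
Proof.
elim: q i => [|q IH] i; first by constructor.
rewrite mulSn -addnA stretchD -[_ ++ _]cat0s; constructor.
  by exists (g ^+ i)%g; rewrite stretch_translate.
by rewrite -mulnDl.
Qed.

Definition flips_axis h m := N * l <= m /\
  forall k, k <= N * l -> act h (A k) = A (m - k).

Lemma flips_axisI h i :
  map (act_edge act h) pattern = reverse_walk (stretch A i (N * l)) ->
  flips_axis h (i + N * l).
Proof.
move=> E; split=> [|k kN]; first exact: leq_addl.
have nthE j : j < N * l ->
    (act h (A j), act h (A j.+1)) = (A (i + N * l - j), A (i + N * l - j.+1)).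
  move=> jN; have := congr1 (fun s => nth (A 0, A 0) s j) E.
  rewrite /reverse_walk (nth_map (A 0, A 0)) ?size_stretch //.
  rewrite nth_rev ?size_map ?size_iota // (nth_map (A 0, A 0)) ?size_stretch; last lia.
  rewrite !(nth_map 0) ?size_iota; try lia.
  rewrite !nth_iota; try lia.
  by rewrite /act_edge /flip /= add0n => -[-> ->]; congr (A _, A _); lia.
move: kN; rewrite leq_eqVlt => /orP[/eqP->|/nthE[]//].
have NlK : (N * l).-1.+1 = N * l by rewrite prednK // muln_gt0 N_gt0.
have lt_Nl : (N * l).-1 < N * l by rewrite NlK.
by have [_] := nthE _ lt_Nl; rewrite NlK.
Qed.

(** The translates of the pattern by the powers of g^N tile the axis, while a
    reversed translate on the axis would provide an element that flips it. *)
Lemma counting_axis m : (forall h k, ~ flips_axis h k) ->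
  ((m %/ N)%:Z <= counting act treeV pattern (A 0) (g ^+ m)%g)%R.
Proof.
move=> noflip; have pat_gt0 : 0 < size pattern.
  by rewrite size_stretch muln_gt0 N_gt0.
rewrite /counting -shift_ray geod_ray //.
rewrite [X in (_ <= _ - X%:Z)%R]packing_number_eq0; last first.
  move=> u s v /(congr1 (@reverse_walk V)).
  rewrite reverse_walkK !reverse_walk_cat -catA => /stretch_infix def_s [h def_h].
  apply: (noflip h (size (reverse_walk v) + N * l)); apply: flips_axisI.
  rewrite -def_h -[LHS]reverse_walkK def_s !size_reverse_walk def_h.
  by rewrite size_map size_stretch.
rewrite subr0 lez_nat; apply: packing_le; first by move=> s; apply: translate_gt0.
rewrite [in stretch _ _ _](divn_eq m N) mulnDl -mulnA -[0](mul0n l).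
exact: packing_axis.
Qed.

(** If h reverses N periods of the axis then g and its conjugate by h translate
    N - 1 of them in opposite directions. *)
Lemma flips_axis_fix h m : flips_axis h m ->
  forall k, k <= N.-1 * l -> act (g ^ h * g)%g (A k) = A k.
Proof.
case=> mN hA k kN; have NlE : N * l = N.-1 * l + l.
  by rewrite -{1}(prednK N_gt0) mulSn addnC.
rewrite /conjg !(actM actP) -shiftA hA; last by lia.
have <- : A (m - (k + l) + l) = act g (A (m - (k + l))) by apply: shiftA.
have -> : m - (k + l) + l = m - k by lia.
by rewrite -hA ?(actK actP) //; lia.
Qed.

(** If g moves the vertices of its axis to their neighbours, then h followed by a
    power of g swaps the ends of the first edge. *)
Lemma flips_axis_inversion h m :
  l = 1 -> flips_axis h m -> ~ without_inversions adj act.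
Proof.
move=> l1 [mN hA] noinv; rewrite l1 muln1 in mN hA.
have A_m k : A (k + m.-1) = act (g ^+ m.-1)%g (A k).
  by rewrite -shift_ray l1 muln1.
have m_gt0 : 0 < m by apply: leq_trans N_gt0 mN.
apply: (noinv ((g ^+ m.-1)^-1 * h)%g (A 0) (A 1)) => //.
rewrite !(actM actP) !hA // subn0 subn1.
by have := A_m 0; have := A_m 1; rewrite add1n prednK // => -> ->; rewrite !(actK actP).
Qed.

End Gap.

(** * The gap theorem *)

Section Dichotomy.
Variables (R : realType) (G : groupType) (V : eqType) (adj : rel V).
Variables (act : G -> V -> V) (K : R).
Hypothesis treeV : is_tree adj.
Hypothesis actP : is_simplicial_action adj act.
Hypothesis noinv : without_inversions adj act.
Hypothesis acyl : acylindrical adj act K.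

(** With l the translation length, the last hypothesis says that N - 1 periods of
    the axis are long enough for acylindricity; periods of a single edge are
    exempt because flipping their axis would require an inversion. *)
Lemma scl_dichotomy g N : hyperbolic R adj act g -> (0 < N)%N ->
  (forall l : nat, (1 < l)%N -> translation_length R adj act g <= l%:R ->
     K <= (N.-1 * l)%:R) ->
  (exists h, (g ^ h)%g = (g^-1)%g) \/ ((1 / (12 * N%:R))%:E <= scl R g)%E.
Proof.
move=> hg N_gt0 K_le.
have nofix v : act g v <> v by apply: (hyperbolic_no_fixpoint actP hg).
have [A [l [l_gt0 adjA nbA shiftA]]] := axis_exists actP treeV noinv nofix.
have [[h [m flip]]|noflip] := pselect (exists h m, flips_axis act A l N h m).
  have [l_gt1|l_le1] := ltnP 1 l; last first.
    have l1 : l = 1%N by apply/eqP; rewrite eqn_leq l_le1.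
    by case: (flips_axis_inversion actP adjA shiftA N_gt0 l1 flip noinv).
  have tl_le : translation_length R adj act g <= l%:R.
    have := walk_stretch adjA 0 l; rewrite shiftA.
    by move/(translation_length_le R actP); rewrite size_stretch.
  left; exists h; apply: (mulIg g); rewrite mulVg.
  apply: (acylindrical_ray actP acyl treeV adjA nbA (K_le _ l_gt1 tl_le)).
  exact: (flips_axis_fix actP shiftA l_gt0 N_gt0 flip).
right; apply: (scl_ge (C := 1 / 12)) => m cm.
have pat_gt0 : (0 < size (stretch A 0 (N * l)))%N.
  by rewrite size_stretch muln_gt0 N_gt0.
have noflip' h k : ~ flips_axis act A l N h k by move=> ?; apply: noflip; exists h, k.
have := counting_axis actP treeV adjA nbA shiftA l_gt0 N_gt0 m noflip'.
move/le_trans/(_ (counting_commutator_product actP treeV pat_gt0 (A 0) (cl_attained cm))).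
set n := cl _; rewrite -PoszM lez_nat => le_n.
have : (m <= (12 * n).+1 * N)%N.
  by apply: leq_trans (ltnW (ltn_ceil m N_gt0)) _; rewrite leq_mul2r ltnS le_n orbT.
rewrite -(ler_nat R) natrM -natr1 natrM => le_m.
have NR : 0 < N%:R :> R by rewrite ltr0n.
have : m%:R / N%:R <= 12 * n%:R + 1 :> R by rewrite ler_pdivrMr.
by rewrite invfM mul1r -mulrA [_ * m%:R]mulrC; lra.
Qed.

End Dichotomy.

Theorem theorem6p11 (R : realType) (G : groupType) (V : eqType) (adj : rel V)
    (act : G -> V -> V) (K : R)
    (tree_T : is_tree adj)
    (act_T : is_simplicial_action adj act)
    (act_noinv : without_inversions adj act)
    (K_ge0 : 0 <= K)
    (act_acyl : acylindrical adj act K) :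
  let N : int := Num.ceil (K / 2 + 1) in
  [/\ forall g : G, hyperbolic R adj act g ->
        scl R g = 0%E \/ ((1 / (12 * N%:~R))%:E <= scl R g)%E,
      forall g : G, hyperbolic R adj act g ->
        K <= translation_length R adj act g ->
        scl R g = 0%E \/ ((1 / 24)%:E <= scl R g)%E
    & forall g : G, hyperbolic R adj act g ->
        (scl R g = 0%E <-> exists h : G, (g ^ h)%g = (g^-1)%g)].
Proof.
move=> N.
have N_ge : K / 2 + 1 <= N%:~R by apply: ceil_ge.
have N_gt0 : 0 < N by rewrite -(ltr_int R); lra.
clearbody N; case: N N_ge N_gt0 => // n N_ge n_gt0.
have dichotomy g : hyperbolic R adj act g ->
    (exists h, (g ^ h)%g = (g^-1)%g) \/ ((1 / (12 * n%:R))%:E <= scl R g)%E.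
  move=> hg; apply: (scl_dichotomy tree_T act_T act_noinv act_acyl hg n_gt0).
  move=> l l_gt1 _; rewrite natrM.
  have n1 : K / 2 <= n.-1%:R.
    by move: N_ge; rewrite -pmulrn -{1}(prednK n_gt0) -natr1; lra.
  (* Periods of length l >= 2 turn n - 1 >= K / 2 into (n - 1) l >= K. *)
  have : n.-1%:R * 2 <= n.-1%:R * l%:R :> R by rewrite ler_wpM2l // ler_nat.
  lra.
split=> g hg.
- by case: (dichotomy g hg) => [[h /inverted_scl_eq0 ->]|]; [left | right].
- move=> K_le.
  have K_le_period l : (1 < l)%N -> translation_length R adj act g <= l%:R ->
      K <= (2.-1 * l)%:R.
    by rewrite mul1n => _; apply: le_trans.
  have [[h /inverted_scl_eq0 ->]|] := scl_dichotomy tree_T act_T act_noinv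
    act_acyl hg (isT : (0 < 2)%N) K_le_period; first by left.
  by rewrite -natrM; right.
- split=> [scl0|[h /inverted_scl_eq0 -> //]].
  case: (dichotomy g hg) => //; rewrite scl0 lee_fin leNgt.
  by rewrite divr_gt0 // mulr_gt0 // ltr0n.
Qed.
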